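(* Let $\mathcal P$ be a hereditary graph class and let $\Gamma$ be a graph limit. Then one of the following alternatives holds: (i) $\Gamma\in\overline{\mathcal P}$, and $G(n,\Gamma)\in\mathcal P$ almost surely for every $n\ge1$. (ii) $\Gamma\notin\overline{\mathcal P}$, and $\mathbb P\bigl(G(n,\Gamma)\in\mathcal P\bigr)\to0$ as $n\to\infty$.
   Context: All graphs are finite and simple (with at least one vertex). $\mathcal U$ is the set of all unlabelled graphs (isomorphism classes of graphs), and $|G|$ is the number of vertices of $G$. A graph class is a subset of $\mathcal U$; it is hereditary if every induced subgraph of a graph in the class is also in the class. A labelled graph is said to belong to a graph class if its isomorphism class does. For graphs $F,G$, $t(F,G)$ is the probability that a uniformly random map $V(F)\to V(G)$ is a graph homomorphism, and $t_{\mathrm{ind}}(F,G)$ is, when $|F|\le|G|$, the probability that a uniformly random injective map $V(F)\to V(G)$ is an isomorphism onto an induced subgraph of $G$ (and $0$ when $|F|>|G|$). The space $\overline{\mathcal U}$: embed $\mathcal U$ in $[0,1]^{\mathcal U}\times[0,1]$ by $G\mapsto((t(F,G))_{F\in\mathcal U},1/|G|)$ and let $\overline{\mathcal U}$ be the closure of the image; it is a compact metrizable space in which $\mathcal U$ is a countable, discrete, dense, open subset. The elements of $\widehat{\mathcal U}:=\overline{\mathcal U}\setminus\mathcal U$ are called graph limits. For each fixed graph $F$, $t(F,\cdot)$ and $t_{\mathrm{ind}}(F,\cdot)$ extend by continuity to $\overline{\mathcal U}$. For a graph class $\mathcal P$, $\overline{\mathcal P}$ is its closure in $\overline{\mathcal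 U}$. For a graph limit $\Gamma$ and $n\ge1$, $G(n,\Gamma)$ is the random graph with vertex set $[n]=\{1,\dots,n\}$ whose distribution is given by $\mathbb P(G(n,\Gamma)=F)=t_{\mathrm{ind}}(F,\Gamma)$ for every (labelled) graph $F$ on $[n]$. *)

(* Defs.v *)
From HB Require Import structures.
From mathcomp Require Import all_boot all_order all_algebra generic_quotient.
From mathcomp Require Import all_classical all_reals all_analysis.

Set Implicit Arguments.
Unset Strict Implicit.
Unset Printing Implicit Defensive.

Import Order.TTheory GRing.Theory Num.Theory.
Import numFieldNormedType.Exports.

Local Open Scope classical_set_scope.
Local Open Scope ring_scope.
Local Open Scope quotient_scope.

Definition simple_adj (V : finType) (e : {ffun V * V -> bool}) : bool :=
  [forall x, ~~ e (x, x)] && [forall x, forall y, e (x, y) == e (y, x)].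

(* Finite simple graphs with vertex set V. *)
Record sgraph (V : finType) :=
  SGraph { edges : {ffun V * V -> bool}; _ : simple_adj edges }.

HB.instance Definition _ (V : finType) := [isSub for @edges V].
HB.instance Definition _ (V : finType) := [Finite of sgraph V by <:].

Definition adj (V : finType) (G : sgraph V) (x y : V) : bool := edges G (x, y).

Lemma edgeless_subproof (V : finType) :
  simple_adj [ffun _ : V * V => false].
Proof.
by apply/andP; split; apply/forallP => x; [|apply/forallP => y]; rewrite !ffunE.
Qed.

Definition edgeless (V : finType) : sgraph V := SGraph (edgeless_subproof V).

(* measurableType requires a distinguished point. *)
HB.instance Definition _ (V : finType) := isPointed.Build (sgraph V) (edgeless V).

HB.instance Definition _ (V : finType) :=
  @isMeasurable.Build default_measure_display (sgraph V) discrete_measurable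
    discrete_measurable0 discrete_measurableC discrete_measurableU.

Lemma induced_subproof (V : finType) (G : sgraph V) (S : {set V}) :
  simple_adj [ffun p : {x | x \in S} * {x | x \in S} =>
                adj G (val p.1) (val p.2)].
Proof.
have /andP[/forallP irr /forallP sym] := valP G.
apply/andP; split; apply/forallP => x; first by rewrite ffunE; exact: irr.
by apply/forallP => y; rewrite !ffunE; exact: (forallP (sym _)).
Qed.

(* G[S] *)
Definition induced (V : finType) (G : sgraph V) (S : {set V}) :
  sgraph {x | x \in S} := SGraph (induced_subproof G S).

Definition isomorphic (V W : finType) (F : sgraph V) (G : sgraph W) : Prop :=
  exists f : V -> W,
    bijective f /\ forall x y, adj G (f x) (f y) = adj F x y.

(* Labelled graphs with vertex set {0, ..., n}; the successor excludes the
   graph without vertices. *)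
Notation lgraph n := (sgraph 'I_n.+1).

Definition anygraph : Type := {n : nat & lgraph n}.
HB.instance Definition _ := Choice.on anygraph.

Definition iso (F G : anygraph) : bool :=
  `[< isomorphic (tagged F) (tagged G) >].

Lemma iso_refl : reflexive iso.
Proof. by move=> G; apply/asboolP; exists id; split=> //; exists id. Qed.

Lemma iso_sym : symmetric iso.
Proof.
suff H F G : iso F G -> iso G F by move=> F G; apply/idP/idP; exact: H.
move=> /asboolP[f [[g fK gK] fE]]; apply/asboolP; exists g.
by split; [exists f|move=> x y; rewrite -fE !gK].
Qed.

Lemma iso_trans : transitive iso.
Proof.
move=> G F H /asboolP[f [bf fE]] /asboolP[g [bg gE]]; apply/asboolP.
exists (g \o f); split; first exact: bij_comp.
by move=> x y; rewrite /= gE fE.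
Qed.

Canonical iso_equiv := EquivRel iso iso_refl iso_sym iso_trans.

(* Unlabelled graphs. *)
Definition U : Type := {eq_quot iso}.
HB.instance Definition _ := Choice.on U.
HB.instance Definition _ := EqQuotient.on U.

Definition unlabel (n : nat) (G : lgraph n) : U :=
  \pi_U (Tagged (fun n => lgraph n) G).

(* The number of vertices of an unlabelled graph, and a labelled copy of it. *)
Definition nvertices (G : U) : nat := (tag (repr G)).+1.
Definition label (G : U) : sgraph 'I_(nvertices G) := tagged (repr G).

Definition hereditary (P : set U) : Prop :=
  forall (G F : U) (S : {set 'I_(nvertices G)}),
    P G -> isomorphic (label F) (induced (label G) S) -> P F.

Section densities.
Variables (R : realType) (V W : finType) (F : sgraph V) (G : sgraph W).

Definition homs : {set {ffun V -> W}} :=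
  [set f : {ffun V -> W} |
    [forall x, forall y, adj F x y ==> adj G (f x) (f y)]].

Definition injections : {set {ffun V -> W}} :=
  [set f : {ffun V -> W} | injectiveb f].

Definition embeddings : {set {ffun V -> W}} :=
  [set f in injections |
    [forall x, forall y, adj G (f x) (f y) == adj F x y]].

Definition hom_density : R := #|homs|%:R / #|{ffun V -> W}|%:R.

Definition ind_density : R :=
  if (#|V| <= #|W|)%N then #|embeddings|%:R / #|injections|%:R else 0.

End densities.

Definition t (R : realType) (F G : U) : R := hom_density R (label F) (label G).

Definition tind (R : realType) (F G : U) : R :=
  ind_density R (label F) (label G).

(* [0,1]^U x [0,1] is closed in the following space, so that closures of
   subsets of the former may be taken in the latter. *)
Notation graph_space R := ({ptws U -> R} * R)%type.

Definition tau (R : realType) (G : U) : graph_space R :=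
  ((fun F => t R F G), (nvertices G)%:R^-1).

Definition Ubar (R : realType) : set (graph_space R) := closure (range (@tau R)).

Definition graph_limits (R : realType) : set (graph_space R) :=
  @Ubar R `\` range (@tau R).

(* Closed sets of Ubar R being closed in graph_space R, this is the closure
   in Ubar R. *)
Definition class_closure (R : realType) (P : set U) : set (graph_space R) :=
  closure (@tau R @` P).

(* The extension of tind F by continuity from U to Ubar: its value at x is the
   limit of tind F G as tau G tends to x. *)
Definition tind_ext (R : realType) (F : U) (x : graph_space R) : R :=
  lim (tind R F @ filter_from (nbhs x) (fun A => @tau R @^-1` A)).

(* X is distributed as G(n+1, Gamma). *)
Definition has_law_G (R : realType) (Gamma : graph_space R) (n : nat)
    (d : measure_display) (T : measurableType d) (Pr : probability T R)
    (X : {RV Pr >-> lgraph n}) : Prop :=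
  forall F : lgraph n,
    distribution Pr X [set F] = (tind_ext (unlabel F) Gamma)%:E.

(* Main.v *)
Require Import Defs.
From mathcomp Require Import all_boot all_order all_algebra generic_quotient.
From mathcomp Require Import all_classical all_reals all_analysis.
From mathcomp Require Import ring lra zify.

(** Part (i) rests on the fact that a graph F outside a hereditary class P does
    not embed in any member of P: tind F vanishes on P, hence tind_ext F Gamma
    = 0 for every Gamma in the closure of P, and G(n, Gamma) takes each of the
    finitely many values outside P with probability 0.

    Part (ii) holds because G(n, Gamma) converges to Gamma in probability. If
    Gamma is not in the closure of P, some neighbourhood of Gamma contains no
    member of P, and G(n, Gamma) leaves this neighbourhood with probability
    tending to 0 ([sample_mass_outside]). The topology being that of pointwise
    convergence of the densities t(F, .), the convergence in probability
    ([typical_cvg]) amounts to a law of large numbers for each t(F, G(n,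
    Gamma)), which is Chebyshev's inequality together with the second moment
    bound
      E (t(F, G(n, Gamma)) - t(F, Gamma))^2 <= (2 |F|)^2 / n
    ([tind_ext_second_moment]).

    This bound is the limit of a bound on finite graphs. Sampling n vertices of
    a finite graph G independently, instead of without replacement, gives the
    pullback of G along a uniformly random map s from [n] to the vertices of G,
    and t(F, G) is the probability that the pullback along a uniformly random
    map from V(F) contains F. The square of t(F, s*G) - t(F, G) is then an
    average over pairs of maps from V(F) to [n], or equivalently over maps from
    V(F) + V(F) to [n]. A pair that is jointly injective contributes nothing
    on average over s, because its composites with s are independent and uniform
    ([avg_precomp_inj]), and the others have proportion at most (2 |F|)^2 / n
    ([pullback_second_moment]). When G tends to a graph limit, |G| tends to
    infinity ([graph_limit_snd]), and sampling with and without replacement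
    become indistinguishable ([ind_density_pullback]). *)

Set Implicit Arguments.
Unset Strict Implicit.
Unset Printing Implicit Defensive.
Import Order.TTheory GRing.Theory Num.Theory.
Import numFieldNormedType.Exports.
Local Open Scope classical_set_scope.
Local Open Scope ring_scope.

(** * Averages over all maps *)

Definition avg (R : realType) (V W : finType) (g : {ffun V -> W} -> R) : R :=
  (\sum_f g f) / #|{ffun V -> W}|%:R.

Section Averages.
Variable R : realType.

Lemma eq_avg (V W : finType) (g h : {ffun V -> W} -> R) :
  g =1 h -> avg g = avg h.
Proof. by move=> gh; congr (_ / _); exact: eq_bigr. Qed.

Lemma card_ffunR_neq0 (V W : finType) (w : W) :
  #|{ffun V -> W}|%:R != 0 :> R.
Proof.
by rewrite pnatr_eq0 -lt0n; apply/card_gt0P; exists [ffun=> w].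
Qed.

Lemma avg_cst (V W : finType) (w : W) (c : R) :
  avg (fun _ : {ffun V -> W} => c) = c.
Proof.
rewrite /avg sumr_const -[X in X / _]mulr_natr mulfK //.
exact: (card_ffunR_neq0 V w).
Qed.

Lemma avgB (V W : finType) (g h : {ffun V -> W} -> R) :
  avg (fun f => g f - h f) = avg g - avg h.
Proof. by rewrite /avg sumrB mulrBl. Qed.

Lemma avg_sum (V W I : finType) (g : I -> {ffun V -> W} -> R) :
  avg (fun f => \sum_i g i f) = \sum_i avg (g i).
Proof. by rewrite /avg exchange_big /= mulr_suml. Qed.

Lemma avgZr (V W : finType) (g : {ffun V -> W} -> R) c :
  avg (fun f => g f * c) = avg g * c.
Proof. by rewrite /avg -mulr_suml mulrAC. Qed.

Lemma exchange_avg (V W X Y : finType)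
    (g : {ffun V -> W} -> {ffun X -> Y} -> R) :
  avg (fun f => avg (g f)) = avg (fun h => avg (g^~ h)).
Proof. by rewrite /avg -!mulr_suml exchange_big /= mulrAC. Qed.

Lemma ler_avg (V W : finType) (g h : {ffun V -> W} -> R) :
  (forall f, g f <= h f) -> avg g <= avg h.
Proof. by move=> gh; rewrite ler_wpM2r ?invr_ge0 // ler_sum. Qed.

Lemma avg_ge0 (V W : finType) (g : {ffun V -> W} -> R) :
  (forall f, 0 <= g f) -> 0 <= avg g.
Proof. by move=> g0; rewrite divr_ge0 ?sumr_ge0. Qed.

Lemma avg_indicator (V W : finType) (P : pred {ffun V -> W}) :
  avg (fun f => (P f)%:R) = #|P|%:R / #|{ffun V -> W}|%:R :> R.
Proof.
by rewrite /avg -natr_sum -big_mkcond sum1_card.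
Qed.

(** The restriction of a uniformly random map to a set of distinct points is
    again uniform; this is the source of all independence below. The fibres of
    precomposition with f are products of singletons and full copies of W, hence
    all have the same cardinality. *)
Lemma avg_precomp_inj (X V W : finType) (w : W) (f : V -> X)
    (g : {ffun V -> W} -> R) :
  injective f ->
  avg (fun s : {ffun X -> W} => g [ffun v => s (f v)]) = avg g.
Proof.
move=> finj.
pose fib (p : {ffun V -> W}) :=
  [pred s : {ffun X -> W} | [ffun v => s (f v)] == p].
pose allowed (p : {ffun V -> W}) (x : X) : pred W :=
  if [pick v | f v == x] is Some v then pred1 (p v) else predT.
have fibE p : fib p =i family (allowed p).
  move=> s; apply/eqP/familyP => [<- x|sP].
    rewrite /allowed; case: pickP => [v /eqP <-|//].
    by rewrite !inE ffunE.
  apply/ffunP => v; rewrite ffunE; have := sP (f v).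
  rewrite /allowed; case: pickP => [v' /eqP/finj ->|/(_ v)];
    last by rewrite eqxx.
  by rewrite inE => /eqP.
have fibC p q : #|fib p| = #|fib q|.
  rewrite (eq_card (fibE p)) (eq_card (fibE q)) !card_family.
  congr foldr; apply: eq_map => x; rewrite /allowed; case: pickP => // v _.
  by rewrite !card1.
pose c := #|fib [ffun=> w]|.
have sumE (h : {ffun V -> W} -> R) :
    \sum_(s : {ffun X -> W}) h [ffun v => s (f v)] = c%:R * \sum_p h p.
  rewrite (partition_big
    (fun s : {ffun X -> W} => [ffun v => s (f v)]) predT) //=.
  rewrite mulr_sumr; apply: eq_bigr => p _.
  rewrite (eq_bigr (fun=> h p)) => [|s /eqP -> //].
  by rewrite sumr_const -[LHS]mulr_natl; congr (_%:R * _); exact: fibC.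
have cardE : #|{ffun X -> W}|%:R = c%:R * #|{ffun V -> W}|%:R :> R.
  by have := sumE (fun=> 1); rewrite !sumr_const.
have := card_ffunR_neq0 X w; rewrite /avg cardE sumE.
rewrite mulf_eq0 negb_or => /andP[c0 _].
by rewrite -mulf_div divff ?mul1r.
Qed.

Lemma avg_postcomp_bij (X V W : finType) (f : W -> X) (g : {ffun V -> X} -> R) :
  bijective f ->
  avg (fun s : {ffun V -> W} => g [ffun v => f (s v)]) = avg g.
Proof.
move=> [f' fK f'K]; rewrite /avg; congr (_ / _).
  rewrite [RHS](reindex (fun s : {ffun V -> W} => [ffun v => f (s v)])) //=.
  exists (fun s : {ffun V -> X} => [ffun v => f' (s v)]) => s _;
    by apply/ffunP => v; rewrite !ffunE.
congr _%:R; rewrite !card_ffun; congr (_ ^ _)%N.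
by apply: (bij_eq_card (f := f)); exists f'.
Qed.

(** Rewriting the square of an average as a single average over maps on V + V
    brings it under [avg_precomp_inj] and [avg_non_injective]. *)
Lemma avg_sumtype (V W : finType) (g : {ffun V -> W} -> R) :
  avg (fun s : {ffun V + V -> W} =>
         g [ffun v => s (inl v)] * g [ffun v => s (inr v)]) = avg g ^+ 2.
Proof.
rewrite /avg expr2 mulf_div; congr (_ / _).
  rewrite big_distrlr /= pair_big /=.
  pose glue (p : {ffun V -> W} * {ffun V -> W}) : {ffun V + V -> W} :=
    [ffun x => match x with inl v => p.1 v | inr v => p.2 v end].
  rewrite (reindex glue) /=.
    apply: eq_bigr => -[p q] _ /=.
    by congr (g _ * g _); apply/ffunP => v; rewrite !ffunE.
  exists (fun s : {ffun V + V -> W} =>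
      ([ffun v => s (inl v)], [ffun v => s (inr v)])) => [[p q] _|s _].
    by congr (_, _); apply/ffunP => v; rewrite !ffunE.
  by apply/ffunP => -[v|v]; rewrite !ffunE.
by rewrite -natrM !card_ffun card_sum expnD.
Qed.

(** The birthday bound: the draw following k distinct ones repeats one of them
    with probability k / n, and these probabilities add up to at most k^2 / n
    over the first k draws. *)
Lemma ffact_expn_ratio_ge (n k : nat) :
  (0 < n)%N -> 1 - (k ^ 2)%:R / n%:R <= (n ^_ k)%:R / (n ^ k)%:R :> R.
Proof.
move=> n0; have n0R : 0 < n%:R :> R by rewrite ltr0n.
elim: k => [|k IH]; first by rewrite ffactn0 expn0 !mul0r subr0 divr1.
have a1 : (n ^_ k)%:R / (n ^ k)%:R <= 1 :> R.
  rewrite ler_pdivrMr ?ltr0n ?expn_gt0 ?n0 // mul1r ler_nat.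
  elim: k {IH} => // k IH; rewrite ffactnSr expnSr.
  by rewrite leq_mul // leq_subr.
have [kn|nk] := leqP k n.
  have -> : (n ^_ k.+1)%:R / (n ^ k.+1)%:R
      = (n ^_ k)%:R / (n ^ k)%:R * (1 - k%:R / n%:R) :> R.
    rewrite ffactnSr expnSr !natrM -mulf_div natrB // mulrBl divff //.
    by rewrite gt_eqF.
  have a0 : 0 <= (n ^_ k)%:R / (n ^ k)%:R :> R by rewrite divr_ge0.
  have k0 : 0 <= k%:R / n%:R :> R by rewrite divr_ge0.
  have kE : (k.+1 ^ 2)%:R / n%:R
      = (k ^ 2)%:R / n%:R + 2 * (k%:R / n%:R) + n%:R^-1 :> R.
    by rewrite -addn1 !natrX natrD; ring.
  have : 0 <= n%:R^-1 :> R by rewrite invr_ge0 ltW.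
  nra.
rewrite (@le_trans _ _ 0) ?divr_ge0 // subr_le0 ler_pdivlMr // mul1r ler_nat.
nia.
Qed.

Lemma avg_non_injective (V W : finType) (w : W) :
  avg (fun f : {ffun V -> W} => (~~ injectiveb f)%:R)
    <= (#|V| ^ 2)%:R / #|W|%:R :> R.
Proof.
have -> : avg (fun f : {ffun V -> W} => (~~ injectiveb f)%:R)
    = 1 - avg (fun f : {ffun V -> W} => (injectiveb f)%:R) :> R.
  rewrite -[X in X - _](avg_cst V w) -avgB; apply: eq_avg => f.
  by case: injectiveb; rewrite ?subrr ?subr0.
rewrite avg_indicator -cardsE card_inj_ffuns card_ffun lerBlDl -lerBlDr.
by apply: ffact_expn_ratio_ge; apply/card_gt0P; exists w.
Qed.

End Averages.

(** * Densities as averages over pullbacks *)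

Lemma pullback_subproof (V W : finType) (f : V -> W) (G : sgraph W) :
  simple_adj [ffun p : V * V => adj G (f p.1) (f p.2)].
Proof.
have /andP[/forallP irr /forallP sym] := valP G.
apply/andP; split; apply/forallP => x; first by rewrite ffunE; exact: irr.
by apply/forallP => y; rewrite !ffunE; exact: (forallP (sym _)).
Qed.

Definition pullback (V W : finType) (f : V -> W) (G : sgraph W) : sgraph V :=
  SGraph (pullback_subproof f G).

Definition subgraph (V : finType) (F H : sgraph V) : bool :=
  [forall x, forall y, adj F x y ==> adj H x y].

(** A measure for induction from the complete graph downwards. *)
Definition nonedges (V : finType) (F : sgraph V) : nat :=
  #|[pred p : V * V | ~~ adj F p.1 p.2]|.

(** The law of the random graph on V obtained by sampling the vertices of G
    independently. Unlike [ind_density], it decomposes [hom_density] without any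
    error term. *)
Definition pullback_density (R : realType) (V W : finType)
    (F : sgraph V) (G : sgraph W) : R :=
  avg (fun f => (pullback f G == F)%:R).

Section Densities.
Variable R : realType.

Lemma adj_pullback (V W : finType) (f : V -> W) (G : sgraph W) x y :
  adj (pullback f G) x y = adj G (f x) (f y).
Proof. by rewrite {1}/adj ffunE. Qed.

Lemma sgraphP (V : finType) (F H : sgraph V) :
  (forall x y, adj F x y = adj H x y) <-> F = H.
Proof.
split=> [FH|-> //]; apply/val_inj/ffunP => -[x y]; exact: FH.
Qed.

Lemma pullback_comp (X V W : finType) (f : X -> V) (s : V -> W)
    (h : X -> W) (G : sgraph W) :
  h =1 s \o f -> pullback f (pullback s G) = pullback h G.
Proof. by move=> hE; apply/sgraphP => x y; rewrite !adj_pullback !hE. Qed.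

Lemma hom_density_avg (V W : finType) (F : sgraph V) (G : sgraph W) :
  hom_density R F G = avg (fun f => (subgraph F (pullback f G))%:R).
Proof.
rewrite avg_indicator /hom_density cardsE; congr (_%:R / _).
apply: eq_card => f; apply: eq_forallb => x; apply: eq_forallb => y.
by rewrite adj_pullback.
Qed.

Lemma sum_pullback_density (V W : finType) (G : sgraph W)
    (g : sgraph V -> R) :
  \sum_H pullback_density R H G * g H
    = avg (fun f : {ffun V -> W} => g (pullback f G)).
Proof.
under eq_bigr => H _ do rewrite -avgZr.
rewrite -avg_sum; apply: eq_avg => f.
rewrite (bigD1 (pullback f G)) //= eqxx mul1r big1 ?addr0 // => H.
by rewrite eq_sym => /negbTE ->; rewrite mul0r.
Qed.

Lemma hom_density_sum (V W : finType) (F : sgraph V) (G : sgraph W) :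
  hom_density R F G = \sum_(H | subgraph F H) pullback_density R H G.
Proof.
rewrite hom_density_avg -(sum_pullback_density G (fun H => (subgraph F H)%:R)).
rewrite [RHS]big_mkcond; apply: eq_bigr => H _.
by case: subgraph; rewrite ?mulr1 ?mulr0.
Qed.

Lemma subgraph_refl (V : finType) (F : sgraph V) : subgraph F F.
Proof. by apply/forallP => x; apply/forallP => y; exact: implybb. Qed.

Lemma subgraph_nonedges (V : finType) (F H : sgraph V) :
  subgraph F H -> H != F -> (nonedges H < nonedges F)%N.
Proof.
move=> /forallP FH HF; apply: proper_card.
have sub : [pred p : V * V | ~~ adj H p.1 p.2]
    \subset [pred p : V * V | ~~ adj F p.1 p.2].
  apply/fintype.subsetP => -[x y]; rewrite !inE /=; apply: contra.
  exact/implyP/(forallP (FH x)).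
rewrite properE sub; apply: contra HF => sub'.
apply/eqP/sgraphP => x y; apply: negb_inj; apply/idP/idP.
  exact: (fintype.subsetP sub (x, y)).
exact: (fintype.subsetP sub' (x, y)).
Qed.

(** Inclusion-exclusion in recursive form: the law of the sample is determined
    by the homomorphism densities, hence converges when they do. *)
Lemma pullback_density_rec (V W : finType) (F : sgraph V) (G : sgraph W) :
  pullback_density R F G
    = hom_density R F G
      - \sum_(H | subgraph F H && (H != F)) pullback_density R H G.
Proof.
rewrite hom_density_sum (bigD1 F) ?subgraph_refl //=.
by rewrite addrK.
Qed.

Lemma isomorphic_pullback (V W : finType) (F : sgraph V) (G : sgraph W) :
  isomorphic F G -> exists2 f : V -> W, bijective f & F = pullback f G.
Proof.
move=> [f [fbij fE]]; exists f => //; apply/sgraphP => x y.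
by rewrite adj_pullback fE.
Qed.

Lemma subgraph_pullback_bij (V V' : finType) (f : V -> V') (F H : sgraph V') :
  bijective f -> subgraph (pullback f F) (pullback f H) = subgraph F H.
Proof.
move=> [g fK gK]; apply/forallP/forallP => FH x; apply/forallP => y.
  by have := forallP (FH (g x)) (g y); rewrite !adj_pullback !gK.
by have := forallP (FH (f x)) (f y); rewrite !adj_pullback.
Qed.

Lemma pullback_bij_inj (V V' : finType) (f : V -> V') :
  bijective f -> injective (@pullback V V' f).
Proof.
move=> [g fK gK] F H /sgraphP FH; apply/sgraphP => x y.
by have := FH (g x) (g y); rewrite !adj_pullback !gK.
Qed.

Lemma hom_density_isomorphic_l (V V' W : finType) (w : W)
    (F : sgraph V) (F' : sgraph V') (G : sgraph W) :
  isomorphic F F' -> hom_density R F G = hom_density R F' G.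
Proof.
move=> /isomorphic_pullback[f fbij ->]; rewrite !hom_density_avg.
rewrite -(avg_precomp_inj w _ (bij_inj fbij)); apply: eq_avg => s.
rewrite -(subgraph_pullback_bij _ _ fbij); congr (subgraph _ _)%:R.
by apply/esym/pullback_comp => v; rewrite ffunE.
Qed.

Lemma pullback_density_isomorphic (V V' W : finType) (w : W)
    (F : sgraph V) (F' : sgraph V') (G : sgraph W) :
  isomorphic F F' -> pullback_density R F G = pullback_density R F' G.
Proof.
move=> /isomorphic_pullback[f fbij ->].
rewrite /pullback_density -(avg_precomp_inj w _ (bij_inj fbij)).
apply: eq_avg => s; rewrite -(inj_eq (pullback_bij_inj fbij)).
congr (_ == _)%:R.
by apply/esym/pullback_comp => v; rewrite ffunE.
Qed.

Lemma hom_density_isomorphic_r (V W W' : finType)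
    (F : sgraph V) (G : sgraph W) (G' : sgraph W') :
  isomorphic G G' -> hom_density R F G = hom_density R F G'.
Proof.
move=> /isomorphic_pullback[f fbij ->]; rewrite !hom_density_avg.
rewrite -(avg_postcomp_bij _ fbij); apply: eq_avg => s; congr (subgraph _ _)%:R.
by apply: pullback_comp => v; rewrite ffunE.
Qed.

(** Sampling with and without replacement differ only when a vertex is drawn
    twice. *)
Lemma ind_density_pullback (V W : finType) (w : W)
    (F : sgraph V) (G : sgraph W) :
  `|ind_density R F G - pullback_density R F G| <= (#|V| ^ 2)%:R / #|W|%:R.
Proof.
pose emb (f : {ffun V -> W}) := injectiveb f && (pullback f G == F).
have W0 : (0 < #|W|)%N by apply/card_gt0P; exists w.
set e : R := (#|V| ^ 2)%:R / #|W|%:R.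
have u0 : 0 <= pullback_density R F G by exact: avg_ge0.
have u1 : pullback_density R F G <= 1.
  rewrite -(avg_cst V w 1); apply: ler_avg => f.
  by case: (_ == _).
rewrite /ind_density; case: leqP => [VW|WV]; last first.
  (* [ind_density] is 0 here, and the claimed bound is at least 1 *)
  rewrite sub0r normrN ger0_norm // (le_trans u1) // ler_pdivlMr ?ltr0n //.
  by rewrite mul1r ler_nat; nia.
have embE : #|embeddings F G|%:R / #|{ffun V -> W}|%:R
    = avg (fun f => (emb f)%:R) :> R.
  rewrite avg_indicator; congr (_%:R / _); apply: eq_card => f.
  rewrite !inE /emb; congr (_ && _); apply/forallP/eqP => [fE|<- x].
    apply/sgraphP => x y; rewrite adj_pullback.
    exact/eqP/(forallP (fE x)).
  by apply/forallP => y; rewrite adj_pullback.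
have le_emb : avg (fun f => (emb f)%:R) <= pullback_density R F G.
  by apply: ler_avg => f; rewrite /emb; case: injectiveb.
have ge_emb : pullback_density R F G - avg (fun f => (emb f)%:R) <= e.
  apply: le_trans (avg_non_injective R V w); rewrite -avgB; apply: ler_avg => f.
  rewrite /emb; case: injectiveb => /=; first by rewrite subrr.
  by case: (_ == _); rewrite ?subr0.
have inj0 : 0 < #|injections V W|%:R :> R.
  by rewrite ltr0n card_inj_ffuns ffact_gt0.
have all0 : 0 < #|{ffun V -> W}|%:R :> R.
  by rewrite lt0r (card_ffunR_neq0 R V w) ler0n.
set i : R := #|injections V W|%:R / #|{ffun V -> W}|%:R.
have i1 : 1 - e <= i.
  by rewrite /i card_inj_ffuns card_ffun; exact: ffact_expn_ratio_ge.
have ile1 : i <= 1.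
  rewrite ler_pdivrMr // mul1r ler_nat.
  by rewrite -cardsT subset_leq_card //; apply/fintype.subsetP => f.
(* d is the density of copies of F among injections, and i the proportion of
   injections among all maps: both d and the pullback density lie between i * d
   and i * d + e *)
set d := _ / _.
have d0 : 0 <= d by rewrite divr_ge0.
have d1 : d <= 1.
  rewrite ler_pdivrMr // mul1r ler_nat subset_leq_card //.
  by apply/fintype.subsetP => f; rewrite inE => /andP[].
have avgE : avg (fun f => (emb f)%:R) = i * d.
  by rewrite -embE /i /d mulrC mulf_div; field; rewrite !gt_eqF.
rewrite avgE in le_emb ge_emb.
have : d * i <= d by rewrite ler_piMr.
have : d * (1 - i) <= 1 - i by rewrite ler_piMl // subr_ge0.
by rewrite ler_norml; move=> *; apply/andP; split; lra.
Qed.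

(** The square is expanded as an average over maps c from V + V to Y. If c is
    injective, the two factors are independent and centred, so c contributes 0;
    otherwise the contribution is at most 1, and such c are rare. *)
Lemma pullback_second_moment (V Y W : finType) (y : Y) (w : W)
    (F : sgraph V) (G : sgraph W) :
  avg (fun s : {ffun Y -> W} =>
      (hom_density R F (pullback s G) - hom_density R F G) ^+ 2)
    <= (#|{: V + V}| ^ 2)%:R / #|Y|%:R.
Proof.
set a := hom_density R F G.
pose h (f : {ffun V -> W}) : R := (subgraph F (pullback f G))%:R - a.
have h0 : avg h = 0.
  by rewrite avgB avg_cst // /a hom_density_avg subrr.
have h1 f : `|h f| <= 1.
  have a0 : 0 <= a by rewrite /a hom_density_avg; exact: avg_ge0.
  have a1 : a <= 1.
    rewrite -(avg_cst V w 1) /a hom_density_avg; apply: ler_avg => g.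
    by case: subgraph.
  by rewrite /h ler_norml; case: subgraph => /=; apply/andP; split; lra.
pose k (s : {ffun Y -> W}) (c : {ffun V + V -> Y}) : R :=
  h [ffun v => s (c (inl v))] * h [ffun v => s (c (inr v))].
have -> : avg (fun s : {ffun Y -> W} =>
      (hom_density R F (pullback s G) - a) ^+ 2)
    = avg (fun s => avg (k s)).
  apply: eq_avg => s.
  have -> : hom_density R F (pullback s G) - a
      = avg (fun f : {ffun V -> Y} => h [ffun v => s (f v)]).
    rewrite avgB avg_cst // hom_density_avg; congr (_ - _).
    apply: eq_avg => f; congr (subgraph _ _)%:R.
    by apply: pullback_comp => v; rewrite ffunE.
  rewrite -avg_sumtype; apply: eq_avg => c.
  by congr (h _ * h _); apply/ffunP => v; rewrite !ffunE.
rewrite exchange_avg; apply: le_trans (avg_non_injective R _ y).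
apply: ler_avg => c; case: injectiveP => /= [cinj|_].
  have -> : avg (k^~ c) = avg h ^+ 2.
    rewrite -avg_sumtype -(avg_precomp_inj w _ cinj); apply: eq_avg => s.
    by congr (h _ * h _); apply/ffunP => v; rewrite !ffunE.
  by rewrite h0 expr0n.
rewrite -[leRHS](avg_cst Y w); apply: ler_avg => s.
by rewrite (le_trans (ler_norm _)) // normrM mulr_ile1.
Qed.

End Densities.

(** * Unlabelled graphs *)

Lemma label_unlabel (n : nat) (F : lgraph n) :
  isomorphic (label (unlabel F)) F.
Proof.
have : iso (repr (unlabel F)) (Tagged (fun n => lgraph n) F).
  by apply/eqmodP; rewrite reprK.
by move=> /asboolP.
Qed.

Lemma unlabel_label (G : U) :
  unlabel (label G : lgraph (tag (repr G))) = G.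
Proof. by rewrite /unlabel /label taggedK reprK. Qed.

Lemma isomorphic_card (V W : finType) (F : sgraph V) (G : sgraph W) :
  isomorphic F G -> #|V| = #|W|.
Proof. by move=> [f [fbij _]]; exact: bij_eq_card fbij. Qed.

Lemma nvertices_unlabel (n : nat) (F : lgraph n) :
  nvertices (unlabel F) = n.+1.
Proof. by have := isomorphic_card (label_unlabel F); rewrite !card_ord. Qed.

Lemma finite_nvertices_le (m : nat) : finite_set [set G | (nvertices G <= m)%N].
Proof.
apply: (@sub_finite_set _ _ (\bigcup_(k in `I_m) range (@unlabel k))).
  move=> G /= Gm; exists (tag (repr G)) => //.
  by exists (label G) => //; exact: unlabel_label.
apply: bigcup_finite => [|k _]; first exact: finite_II.
exact/finite_image/finite_finset.
Qed.

Definition vertex0 (G : U) : 'I_(nvertices G) := ord0.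

(** [hereditary] speaks of vertex subsets; the subset used is the image of the
    embedding. *)
Lemma hereditary_embedding (P : set U) (F G : U)
    (f : 'I_(nvertices F) -> 'I_(nvertices G)) :
  hereditary P -> injective f -> label F = pullback f (label G) ->
  P G -> P F.
Proof.
move=> hP finj fE PG; apply: (hP G F (f @: predT)%SET PG).
pose g (v : 'I_(nvertices F)) : {w | w \in (f @: predT)%SET} :=
  exist _ (f v) (imset_f f isT).
exists g; split.
  apply: inj_card_bij => [u v [/finj]//|].
  rewrite card_sig -(card_imset predT finj) leq_eqVlt; apply/orP; left.
  exact/eqP/eq_card.
by move=> u v; rewrite fE adj_pullback {1}/adj ffunE.
Qed.

Section Limits.
Variable R : realType.

(** * The topology of the graph space *)

Lemma evaluation_continuous (F : U) :
  continuous (fun x : graph_space R => x.1 F).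
Proof.
move=> x; apply: (@cvg_comp _ _ _ fst (fun f => f F) _
  (nbhs (x.1 : {ptws U -> R}))).
  exact: cvg_fst.
exact: (@proj_continuous U (fun=> R) F).
Qed.

Lemma snd_continuous : continuous (fun x : graph_space R => x.2).
Proof. move=> x; exact: cvg_snd. Qed.

Lemma cvg_graph_space (T : Type) (H : set_system T) (f : T -> graph_space R)
    (x : graph_space R) : Filter H ->
  (forall F, (f y).1 F @[y --> H] --> x.1 F) ->
  (f y).2 @[y --> H] --> x.2 ->
  f @ H --> x.
Proof.
case: x => x1 x2 /= HF h1 h2.
have -> : f = fun y => ((f y).1, (f y).2).
  by apply/funext => y; case: (f y).
apply: (@cvg_pair _ _ _ H (nbhs (x1 : {ptws U -> R})) (nbhs x2)) => //.
apply/cvg_sup => F; apply/cvg_image.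
  by rewrite eqEsubset; split => // r _; exists (fun=> r).
move=> A /h1 hA; exists (@^~ F @^-1` A) => //.
by rewrite eqEsubset; split => [r [g + <-]|r Ar] //; exists (fun=> r).
Qed.

Lemma graph_space_accessible : accessible_space (graph_space R).
Proof.
move=> x y /eqP xy.
have sep (c : graph_space R -> R) : continuous c -> c x <> c y ->
    exists A, [/\ open A, x \in A & y \in ~` A].
  move=> ccont cxy; exists (c @^-1` (~` [set c y])); split.
  - apply: open_comp => [z _|]; first exact: ccont.
    apply/closed_openC/accessible_closed_set1/hausdorff_accessible.
    exact: Rhausdorff.
  - exact/mem_set.
  - by apply/mem_set => /=; apply.
have [x2y2|] := EM (x.2 = y.2); last exact: (sep _ snd_continuous).
have [F] : exists F, x.1 F <> y.1 F.
  apply: contra_notP xy => /forallNP xy1.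
  case: x y x2y2 xy1 {sep} => [x1 x2] [y1 y2] /= -> xy1; congr (_, _).
  by apply/funext => F; exact: contrapT (xy1 F).
exact: (sep _ (@evaluation_continuous F)).
Qed.

(** * Neighbourhoods of a graph limit *)

(** The filter along which [tind_ext] takes its limit. *)
Definition near_graphs (x : graph_space R) : set_system U :=
  filter_from (nbhs x) (fun A => @tau R @^-1` A).

Lemma near_graphs_filter x : Filter (near_graphs x).
Proof.
apply: filter_from_filter; first by exists setT; exact: filterT.
by move=> A B xA xB; exists (A `&` B) => //; exact: filterI.
Qed.
#[local] Existing Instance near_graphs_filter.

Lemma near_graphs_proper x : Ubar x -> ProperFilter (near_graphs x).
Proof.
move=> xU; apply: filter_from_proper => A /xU [_ [[G _ <-] AG]].
by exists G.
Qed.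

Lemma tau_cvg x : @tau R @ near_graphs x --> x.
Proof. by move=> A xA; exists A. Qed.

Lemma t_cvg (x : graph_space R) F : t R F @ near_graphs x --> x.1 F.
Proof. exact: (cvg_comp (@tau R) (fun y => y.1 F) (@tau_cvg x)
  (@evaluation_continuous F x)). Qed.

Lemma inv_nvertices_cvg x : (nvertices G)%:R^-1 @[G --> near_graphs x] --> x.2.
Proof. exact: (cvg_comp (@tau R) snd (@tau_cvg x) (@snd_continuous x)). Qed.

(** If the last coordinate were nonzero, the graphs near x would have bounded
    order. There are finitely many of these, so their image is closed and x
    would be the image of one of them. *)
Lemma graph_limit_snd (x : graph_space R) : graph_limits x -> x.2 = 0.
Proof.
move=> [xU xtau]; have xP := near_graphs_proper xU.
apply: contra_notP xtau => /eqP x20.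
have [m mP] : exists m, \forall G \near near_graphs x, (nvertices G <= m)%N.
  have x2 : 0 < `|x.2| by rewrite normr_gt0.
  exists (Num.truncn (2 / `|x.2|)); near=> G.
  rewrite -ltnS -(ltr_nat R) (le_lt_trans _ (truncnS_gt _)) //.
  have N0 : 0 < (nvertices G)%:R :> R by rewrite ltr0n.
  have : `|x.2| / 2 < `|(nvertices G)%:R^-1|.
    near: G; apply: (@cvgr_norm_gt _ _ _ _ _ _ _ (@inv_nvertices_cvg x)).
    by rewrite ltr_pdivrMr // mulr_natr mulr2n ltrDl.
  rewrite gtr0_norm ?invr_gt0 // ltr_pdivrMr // mulrC -ltr_pdivrMr ?invr_gt0 //.
  rewrite invrK => lt2; apply/ltW.
  by rewrite ltr_pdivlMr // mulrC.
have cl : closed (@tau R @` [set G | (nvertices G <= m)%N]).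
  apply: (proj1 accessible_finite_set_closed graph_space_accessible).
  exact/finite_image/finite_nvertices_le.
suff : (@tau R @` [set G | (nvertices G <= m)%N]) x.
  by move=> [G _ <-]; exists G.
apply: cl => A xA.
have [G [Gm AG]] : ([set G | (nvertices G <= m)%N] `&` @tau R @^-1` A) !=set0.
  apply: (@filter_ex _ (near_graphs x)); apply: filterI => //.
  by exists A.
by exists (tau R G); split => //; exists G.
Unshelve. all: by end_near. Qed.

(** * Convergence of densities near a graph limit *)

Lemma hom_density_cvg (x : graph_space R) n (F : lgraph n) :
  hom_density R F (label G) @[G --> near_graphs x] --> x.1 (unlabel F).
Proof.
have -> : (fun G => hom_density R F (label G)) = t R (unlabel F).
  apply/funext => G; apply/esym/(hom_density_isomorphic_l _ (vertex0 G)).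
  exact: label_unlabel.
exact: t_cvg.
Qed.

Lemma pullback_density_is_cvg (x : graph_space R) n (F : lgraph n) :
  cvg (pullback_density R F (label G) @[G --> near_graphs x]).
Proof.
have [m] := ubnP (nonedges F); elim: m F => // m IH F; rewrite ltnS => Fm.
have sum_cvg : \sum_(H | subgraph F H && (H != F))
      pullback_density R H (label G) @[G --> near_graphs x] -->
    \sum_(H | subgraph F H && (H != F))
      lim (pullback_density R H (label G) @[G --> near_graphs x]).
  apply: cvg_big => [|H /andP[FH HF]]; first exact: add_continuous.
  apply: IH; apply: leq_trans Fm; exact: subgraph_nonedges.
have -> : (fun G => pullback_density R F (label G))
    = (fun G => hom_density R F (label G)
        - \sum_(H | subgraph F H && (H != F)) pullback_density R H (label G)).
  by apply/funext => G; exact: pullback_density_rec.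
by apply: cvgP; apply: cvgB sum_cvg; exact: hom_density_cvg.
Qed.

(** Repeated vertices become improbable, because the order of the graphs near a
    graph limit tends to infinity. *)
Lemma tind_sub_pullback_density_cvg (x : graph_space R) n (F : lgraph n) :
  graph_limits x ->
  tind R (unlabel F) G - pullback_density R F (label G)
    @[G --> near_graphs x] --> 0.
Proof.
move=> xlim; apply/norm_cvg0P.
apply: (@squeeze_cvgr _ _ _ _ (fun=> 0)
  (fun G => (n.+1 ^ 2)%:R * (nvertices G)%:R^-1)).
- near=> G; rewrite normr_ge0 /=.
  have -> : pullback_density R F (label G)
      = pullback_density R (label (unlabel F)) (label G).
    apply/esym/(pullback_density_isomorphic _ (vertex0 G)).
    exact: label_unlabel.
  have := ind_density_pullback R (vertex0 G) (label (unlabel F)) (label G).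
  by rewrite !card_ord => /le_trans; apply; rewrite nvertices_unlabel.
- exact: cvg_cst.
- rewrite -[X in _ --> X](mulr0 (n.+1 ^ 2)%:R) -(graph_limit_snd xlim).
  apply: cvgMr; exact: inv_nvertices_cvg.
Unshelve. all: by end_near. Qed.

Lemma tind_cvg (x : graph_space R) n (F : lgraph n) : graph_limits x ->
  tind R (unlabel F) @ near_graphs x --> tind_ext (unlabel F) x.
Proof.
move=> xlim.
suff : cvg (tind R (unlabel F) @ near_graphs x) by [].
have -> : tind R (unlabel F) = (fun G =>
    tind R (unlabel F) G - pullback_density R F (label G)
      + pullback_density R F (label G)).
  by apply/funext => G; rewrite subrK.
apply: cvgP; apply: cvgD (@pullback_density_is_cvg x n F).
exact: tind_sub_pullback_density_cvg.
Qed.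

Lemma pullback_density_cvg (x : graph_space R) n (F : lgraph n) :
  graph_limits x ->
  pullback_density R F (label G) @[G --> near_graphs x]
    --> tind_ext (unlabel F) x.
Proof.
move=> xlim.
have -> : (fun G => pullback_density R F (label G)) = (fun G =>
    tind R (unlabel F) G
      - (tind R (unlabel F) G - pullback_density R F (label G))).
  by apply/funext => G; rewrite subKr.
rewrite -[X in _ --> X]subr0; apply: cvgB; first exact: tind_cvg.
exact: tind_sub_pullback_density_cvg.
Qed.

Lemma tind_ext_ge0 (x : graph_space R) n (F : lgraph n) : graph_limits x ->
  0 <= tind_ext (unlabel F) x :> R.
Proof.
move=> xlim; have xP := near_graphs_proper xlim.1.
rewrite -(cvg_lim (@Rhausdorff R) (@pullback_density_cvg x n F xlim)).
apply: limr_ge; first exact: pullback_density_is_cvg.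
by near=> G; exact: avg_ge0.
Unshelve. all: by end_near. Qed.

Lemma tind_ext_second_moment (x : graph_space R) n F : graph_limits x ->
  \sum_(H : lgraph n) tind_ext (unlabel H) x * (t R F (unlabel H) - x.1 F) ^+ 2
    <= ((nvertices F + nvertices F) ^ 2)%:R / n.+1%:R.
Proof.
move=> xlim; have xP := near_graphs_proper xlim.1.
set C := leRHS.
pose S (G : U) := \sum_(H : lgraph n) pullback_density R H (label G)
  * (t R F (unlabel H) - t R F G) ^+ 2.
have Scvg : S G @[G --> near_graphs x] --> \sum_(H : lgraph n)
    tind_ext (unlabel H) x * (t R F (unlabel H) - x.1 F) ^+ 2.
  apply: cvg_big => [|H _]; first exact: add_continuous.
  apply: cvgM; first exact: pullback_density_cvg.
  apply: (cvg_comp (fun G => t R F (unlabel H) - t R F G) (fun r => r ^+ 2)).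
    by apply: cvgB; [exact: cvg_cst | exact: t_cvg].
  exact: exprn_continuous.
rewrite -(cvg_lim (@Rhausdorff R) Scvg); apply: limr_le.
  exact: cvgP Scvg.
near=> G.
have := pullback_second_moment R (ord0 : 'I_n.+1) (vertex0 G)
  (label F) (label G).
rewrite card_sum !card_ord; apply: le_trans; rewrite le_eqVlt; apply/orP; left.
apply/eqP; rewrite -(sum_pullback_density (label G) (fun H : lgraph n =>
  (hom_density R (label F) H - hom_density R (label F) (label G)) ^+ 2)).
apply: eq_bigr => H _; congr (_ * (_ - _) ^+ 2).
apply: hom_density_isomorphic_r; exact: label_unlabel.
Unshelve. all: by end_near. Qed.

(** * Densities on a hereditary class *)

Lemma tind_eq0 (P : set U) (F G : U) :
  hereditary P -> P G -> ~ P F -> tind R F G = 0.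
Proof.
move=> hP PG PF; rewrite /tind /ind_density; case: ifP => // _.
suff -> : embeddings (label F) (label G) = finset.set0 by rewrite cards0 mul0r.
apply/finset.setP => f; rewrite !inE.
apply/negbTE/negP => /andP[/injectiveP finj /forallP fE].
apply: PF; apply: hereditary_embedding hP finj _ PG.
by apply/sgraphP => u v; rewrite adj_pullback; apply/esym/eqP/(forallP (fE u)).
Qed.

(** The limit defining [tind_ext] may be evaluated along members of P. *)
Lemma tind_ext_eq0 (P : set U) (x : graph_space R) n (F : lgraph n) :
  hereditary P -> graph_limits x -> class_closure P x -> ~ P (unlabel F) ->
  tind_ext (unlabel F) x = 0.
Proof.
move=> hP xlim xP PF; apply/eqP; rewrite -[_ == _]negbK; apply/negP => tx0.
have [A xA At] : near_graphs x [set G | tind R (unlabel F) G != 0].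
  exact: (@cvgr_neq0 R R _ _ _ _ _ (@tind_cvg x n F xlim) tx0).
have [_ [[G PG <-] AG]] := xP A xA.
by have /eqP := At G AG; apply; exact: tind_eq0 hP PG PF.
Qed.

(** * Random samples from a graph limit *)

(** The probability that G(n + 1, x) belongs to A, expressed without reference
    to a probability space. *)
Definition sample_mass (x : graph_space R) (n : nat) (A : set U) : R :=
  \sum_(H : lgraph n | `[< A (unlabel H) >]) tind_ext (unlabel H) x.

Lemma prob_sample (x : graph_space R) (n : nat) (d : measure_display)
    (T : measurableType d) (Pr : probability T R) (X : {RV Pr >-> lgraph n})
    (A : set U) :
  has_law_G x X -> Pr [set w | A (unlabel (X w))] = (sample_mass x n A)%:E.
Proof.
move=> hX.
pose D : set (lgraph n) := [set` [pred H | `[< A (unlabel H) >]]].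
have -> : [set w | A (unlabel (X w))] = \bigcup_(H in D) (X @^-1` [set H]).
  apply/seteqP; split => [w Aw|w [H /asboolP AH /= XwH]].
    by exists (X w) => //; exact/asboolP.
  by rewrite XwH.
rewrite measure_fin_bigcup.
- rewrite -(@bigfs _ _ _ _ (index_enum (lgraph n))) ?index_enum_uniq //;
    last first.
    by move=> H _; rewrite mem_index_enum.
  rewrite -sumEFin; apply: eq_bigr => H _; exact: hX.
- exact: finite_finset.
- by apply/trivIsetP => H K _ _ HK; apply/seteqP; split => // w [/= XH XK];
    move: HK; rewrite -XH -XK eqxx.
- move=> H _; exact: measurable_funPTI.
Qed.

(** Sets of graphs that contain the samples with probability tending to 1.
    Convergence of [tau] along this filter is convergence in probability of the
    samples. *)
Definition typical (x : graph_space R) : set_system U :=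
  [set A | sample_mass x n (~` A) @[n --> \oo] --> 0].

Section Sampling.
Variables (x : graph_space R) (xlim : graph_limits x).

Lemma sample_mass_ge0 n A : 0 <= sample_mass x n A.
Proof. by apply: sumr_ge0 => H _; exact: tind_ext_ge0. Qed.

Lemma sample_mass_subset n A B :
  A `<=` B -> sample_mass x n A <= sample_mass x n B.
Proof.
move=> AB; rewrite /sample_mass [leLHS]big_mkcond [leRHS]big_mkcond /=.
apply: ler_sum => H _; have t0 := tind_ext_ge0 H xlim.
by case: asboolP => [/AB AH|_]; case: asboolP.
Qed.

Lemma sample_massU n A B :
  sample_mass x n (A `|` B) <= sample_mass x n A + sample_mass x n B.
Proof.
rewrite /sample_mass big_mkcond [X in _ <= X + _]big_mkcond.
rewrite [X in _ <= _ + X]big_mkcond -big_split /=.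
apply: ler_sum => H _; have t0 := tind_ext_ge0 H xlim.
case: asboolP => [|_]; last first.
  by apply: addr_ge0; case: ifP.
case=> /asboolP -> ; rewrite ?lerDl ?lerDr; by case: ifP.
Qed.

Lemma sample_mass_cvg0 A (u : nat -> R) :
  (\forall n \near \oo, sample_mass x n A <= u n) -> u @ \oo --> 0 ->
  sample_mass x n A @[n --> \oo] --> 0.
Proof.
move=> Au u0; apply: (squeeze_cvgr _ (cvg_cst 0) u0).
by near=> n; rewrite sample_mass_ge0 /=; near: n.
Unshelve. all: by end_near. Qed.

Lemma typical_filter : Filter (typical x).
Proof.
split.
- rewrite /typical /= setCT; apply: sample_mass_cvg0 (cvg_cst 0).
  by near=> n; rewrite /sample_mass big_pred0 // => H; apply/asboolP.
- move=> A B A0 B0; rewrite /typical /= setCI.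
  apply: (@sample_mass_cvg0 _
    (fun n => sample_mass x n (~` A) + sample_mass x n (~` B))).
    by near=> n; exact: sample_massU.
  by rewrite -[X in _ --> X]addr0; exact: cvgD.
- move=> A B AB A0; apply: sample_mass_cvg0 A0.
  by near=> n; apply: sample_mass_subset; exact: subsetC.
Unshelve. all: by end_near. Qed.

Lemma typical_cvg : @tau R @ typical x --> x.
Proof.
have tF := typical_filter.
apply: cvg_graph_space => [F|].
  apply/cvgrPdist_lt => e e0.
  set C : R := ((nvertices F + nvertices F) ^ 2)%:R.
  apply: (@sample_mass_cvg0 _ (fun n => (C / e ^+ 2) * harmonic n)); last first.
    rewrite -[X in _ --> X](mulr0 (C / e ^+ 2)); apply: cvgMr.
    exact: cvg_harmonic.
  near=> n.
  (* Chebyshev's inequality, multiplied by the square of e *)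
  have := tind_ext_second_moment n F xlim; rewrite -/C => mom.
  rewrite /harmonic /= mulrAC ler_pdivlMr ?exprn_gt0 //; apply: le_trans mom.
  rewrite /sample_mass big_mkcond mulr_suml; apply: ler_sum => H _.
  have t0 := tind_ext_ge0 H xlim.
  case: asboolP => [|_]; last by rewrite mul0r mulr_ge0 ?sqr_ge0.
  move=> /negP; rewrite -leNgt => le_e; apply: ler_wpM2l => //.
  rewrite -[leRHS]real_normK ?num_real // distrC.
  by rewrite ler_pXn2r // nnegrE ltW.
rewrite (graph_limit_snd xlim); apply/cvgrPdist_lt => e e0.
apply: sample_mass_cvg0 (cvg_cst 0).
near=> n; rewrite /sample_mass big_pred0 // => H; apply/asboolP => /=; apply.
rewrite sub0r normrN nvertices_unlabel ger0_norm ?invr_ge0 //.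
near: n; exact: (cvgr_lt _ cvg_harmonic).
Unshelve. all: by end_near. Qed.

(** The class misses a neighbourhood of x, and the samples hit this
    neighbourhood with probability tending to 1. *)
Lemma sample_mass_outside (P : set U) :
  ~ class_closure P x -> sample_mass x n P @[n --> \oo] --> 0.
Proof.
move=> xP.
have [A xA AP] : exists2 A, nbhs x A & forall G, P G -> ~ A (tau R G).
  apply: contra_notP xP => noA A xA; apply: contrapT => AP0; apply: noA.
  exists A => // G PG AG; apply: AP0; exists (tau R G).
  by split => //; exists G.
apply: (@sample_mass_cvg0 _ (fun n => sample_mass x n (~` (@tau R @^-1` A)))).
  by near=> n; apply: sample_mass_subset => G /AP.
exact: typical_cvg xA.
Unshelve. all: by end_near. Qed.

End Sampling.

End Limits.

(* X n is the random graph G(n+1, Gamma), so that n ranges over all of nat. *)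
Theorem theorem3p2 (R : realType) (P : set U) (hP : hereditary P)
    (Gamma : graph_space R) (hGamma : graph_limits Gamma)
    (d : nat -> measure_display) (T : forall n, measurableType (d n))
    (Pr : forall n, probability (T n) R)
    (X : forall n, {RV (Pr n) >-> lgraph n})
    (hX : forall n, has_law_G Gamma (X n)) :
  (class_closure P Gamma /\
     forall n, \forall w \ae Pr n, P (unlabel (X n w))) \/
  (~ class_closure P Gamma /\
     Pr n [set w | P (unlabel (X n w))] @[n --> \oo] --> 0%E).
Proof.
have [inP|outP] := EM (class_closure P Gamma); [left|right]; split => //.
  move=> n; exists (X n @^-1` [set H | ~ P (unlabel H)]); split => //.
    exact: measurable_funPTI.
  transitivity ((sample_mass Gamma n (~` P))%:E); first exact: prob_sample.
  rewrite /sample_mass big1 // => H /asboolP PH; exact: tind_ext_eq0 PH.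
have -> : (fun n => Pr n [set w | P (unlabel (X n w))])
    = (fun n => (sample_mass Gamma n P)%:E).
  by apply/funext => n; exact: prob_sample.
apply: cvg_EFin; first exact: nearW.
exact: (sample_mass_outside hGamma outP).
Qed.
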